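(* Let $r\ge 2$ be an integer and write $r=a+3b$ with $a\in\{2,3,4\}$ and $b\ge 0$ an integer. Then \[w(k;r) > (a3^b)^{(1-o_r(1))k},\] where $o_r(1)$ denotes a quantity tending to $0$ as $k\to\infty$ with $r$ fixed; that is, for every integer $r\ge 2$ and every $\eta>0$ there exists $K$ such that $w(k;r)>(a3^b)^{(1-\eta)k}$ for all integers $k>K$. Moreover, in terms of the inverse function, \[f_r(N)\le O\left(\frac{\log N}{r}\right)+O_r(1);\] that is, there exist an absolute constant $C>0$ and, for each integer $r\ge 2$, a constant $D_r$ such that $f_r(N)\le C\,\frac{\log N}{r}+D_r$ for all integers $N\ge 1$.
   Context: For a positive integer $n$, $[n]=\{1,\dots,n\}$. A $k$-term arithmetic progression of integers is a set $\{x,x+d,\dots,x+(k-1)d\}$ with $d\ne 0$. For positive integers $k,r$, the van der Waerden number $w(k;r)$ is the smallest integer $N$ such that for every $r$-coloring $c:[N]\to[r]$ there exists a monochromatic $k$-term arithmetic progression in $[N]$. The function $f_r(N)$ is the smallest $k$ such that there exists an $r$-coloring $c:[N]\to[r]$ with no monochromatic arithmetic progression of length $k$. *)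

(* Defs.v *)
From HB Require Import structures.
From mathcomp Require Import all_boot all_order all_algebra zify.
From mathcomp Require Import all_classical all_reals all_analysis.

Set Implicit Arguments.
Unset Strict Implicit.
Unset Printing Implicit Defensive.

Import Order.TTheory GRing.Theory Num.Theory.

Local Open Scope nat_scope.

(* The element i of 'I_N stands for the integer i + 1 of [N] = {1, ..., N}.
   The progression x, x + d, ..., x + (k-1)d is one of integers: d may be
   negative, and every one of its terms has to lie in [N]. *)
Definition has_mono_AP (r N k : nat) (c : {ffun 'I_N -> 'I_r}) : Prop :=
  exists (x d : int) (col : 'I_r), d <> 0%R /\
    forall i : nat, i < k ->
      exists2 y : 'I_N, Posz y.+1 = (x + i%:Z * d)%R & c y = col.

(* The default value 0 is never taken by vdW, nor by vdW_inv when 0 < r: see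
   vdW_exists and vdW_inv_exists. *)
Definition least (P : nat -> Prop) : nat :=
  if pselect (exists n, `[< P n >]) is left exP then ex_minn exP else 0.

Definition vdW (k r : nat) : nat :=
  least (fun N => forall c : {ffun 'I_N -> 'I_r}, has_mono_AP k c).

(* f_r(N); the value 0 is impossible for 0 < r, as the empty progression is
   vacuously monochromatic. *)
Definition vdW_inv (r N : nat) : nat :=
  least (fun k => exists c : {ffun 'I_N -> 'I_r}, ~ has_mono_AP k c).

Lemma leastP (P : nat -> Prop) : (exists n, P n) ->
  P (least P) /\ forall n, P n -> least P <= n.
Proof.
move=> [n0 Pn0]; rewrite /least; case: pselect => [exP|[]]; last first.
  by exists n0; apply/asboolP.
case: ex_minnP => m /asboolP Pm min_m; split=> // n Pn.
by apply: min_m; apply/asboolP.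
Qed.

Lemma vdW_inv_exists (r N : nat) : 0 < r ->
  exists k, exists c : {ffun 'I_N -> 'I_r}, ~ has_mono_AP k c.
Proof.
case: r => // r _; exists N.+1, [ffun=> ord0] => -[x [d [col [d0 H]]]].
have H' (i : 'I_N.+1) : {y : 'I_N | Posz y.+1 = (x + i%:Z * d)%R}.
  by apply: cid; have [y] := H i (ltn_ord i); exists y.
have inj_g : injective (fun i => sval (H' i)).
  move=> i j /= e; apply: val_inj => /=.
  have := svalP (H' i); rewrite e (svalP (H' j)) => /addrI.
  by move=> /(mulIf (introN eqP d0)) [].
by have := leq_card _ inj_g; rewrite !card_ord ltnn.
Qed.

(* Van der Waerden's theorem, by colour focusing: in vdW_focus, F is the
   common focus and ds lists the differences of s progressions of k + 1 terms
   ending just before F, each monochromatic, in pairwise distinct colours. *)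
Definition vdW_nat (k : nat) : Prop := forall C : finType, exists N,
  forall c : nat -> C, exists a d,
    [/\ 0 < d, d <= N, a + k * d < N &
        forall i, i <= k -> c (a + i * d) = c a].

Lemma vdW_focus (k : nat) (C : finType) : vdW_nat k -> forall s, exists N,
  forall c : nat -> C,
    (exists a d, [/\ 0 < d, d <= N, a + k.+1 * d < N &
        forall i, i <= k.+1 -> c (a + i * d) = c a]) \/
    (exists F (ds : seq nat), [/\ F < N, size ds = s,
        uniq [seq c (F - d) | d <- ds] &
        forall d, d \in ds -> [/\ 0 < d, k.+1 * d <= F &
          forall i, i <= k -> c (F - i.+1 * d) = c (F - d)]]).
Proof.
move=> Pk; elim=> [|s [N Qs]].
  by exists 1 => c; right; exists 0, [::].
have [M HM] := Pk {ffun 'I_N -> C}; exists (M.*2.+1 * N) => c.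
have [a [d [d0 dM aM Hb]]] := HM (fun m => [ffun i : 'I_N => c (m * N + i)]).
have {}Hb i p : i <= k -> p < N -> c ((a + i * d) * N + p) = c (a * N + p).
  by move=> ik pN; have /ffunP/(_ (Ordinal pN)) := Hb i ik; rewrite !ffunE.
have mono a' d' : 0 < d' -> d' <= N -> a' + k.+1 * d' < N ->
    (forall i, i <= k.+1 -> c (a * N + (a' + i * d')) = c (a * N + a')) ->
    exists a d, [/\ 0 < d, d <= M.*2.+1 * N, a + k.+1 * d < M.*2.+1 * N &
        forall i, i <= k.+1 -> c (a + i * d) = c a].
  move=> d'0 d'N a'N H; exists (a * N + a'), d'; split=> //.
  - by rewrite (leq_trans d'N) // leq_pmull.
  - by nia.
  - by move=> i ik; rewrite -addnA H.
have [[a' [d' [? ? ? H]]]|[F [ds [FN sds uds Hds]]]] :=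
    Qs (fun x => c (a * N + x)).
  by left; exact: (mono a' d').
have [/mapP[d' d'ds eF]|nF] :=
    boolP (c (a * N + F) \in [seq c (a * N + (F - d)) | d <- ds]).
  left; have [d'0 kd H] := Hds _ d'ds.
  have H' i : i <= k.+1 -> c (a * N + (F - i * d')) = c (a * N + (F - d')).
    by case: i => [_|i /H//]; rewrite mul0n subn0.
  apply: (mono (F - k.+1 * d') d') => //; [nia|nia|] => i ik.
  rewrite H' //.
  have -> : F - k.+1 * d' + i * d' = F - (k.+1 - i) * d' by nia.
  by rewrite H' // leq_subr.
right; exists ((a + k.+1 * d) * N + F), (d * N :: [seq e + d * N | e <- ds]).
have key e i : k.+1 * e <= F -> i <= k ->
    c ((a + k.+1 * d) * N + F - i.+1 * (e + d * N)) = c (a * N + (F - i.+1 * e)).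
  move=> ke ik.
  have ie : i.+1 * e <= F by apply: leq_trans ke; rewrite leq_mul2r ltnS ik orbT.
  rewrite -(Hb (k - i)); [|exact: leq_subr|lia].
  congr c.
  have -> : k.+1 * d = (k - i) * d + i.+1 * d by rewrite -mulnDl; congr (_ * _); lia.
  rewrite mulnDr mulnA; move: (i.+1 * d) (i.+1 * e) ie => Y Z ZF.
  by rewrite addnA [(_ + Y) * N]mulnDl; move: (_ * N) (Y * N) => A B; lia.
have key1 e : k.+1 * e <= F ->
    c ((a + k.+1 * d) * N + F - (e + d * N)) = c (a * N + (F - e)).
  by move=> ke; have := key e 0 ke isT; rewrite !mul1n.
split.
- have : a + k.+1 * d <= M.*2 by rewrite mulSn; lia.
  by move=> h; rewrite mulSn addnC -addSn leq_add // leq_mul2r h orbT.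
- by rewrite /= size_map sds.
- rewrite /= -map_comp.
  have -> : [seq (fun e => c ((a + k.+1 * d) * N + F - e)) (e + d * N) | e <- ds]
      = [seq c (a * N + (F - e)) | e <- ds].
    by apply/eq_in_map => e /Hds[_ ke _]; exact: key1.
  rewrite /comp uds andbT.
  by have := key1 0; rewrite muln0 add0n subn0 => ->.
- have N0 : 0 < N by exact: leq_ltn_trans FN.
  move=> e; rewrite inE => /predU1P[->|/mapP[e' /Hds[e'0 ke' He'] ->]].
    split; [by rewrite muln_gt0 d0| |].
      by rewrite mulnA; nia.
    move=> i ik; have := key 0 i; have := key1 0.
    by rewrite !muln0 !add0n !subn0 => -> // ->.
  split; [by rewrite addn_gt0 e'0|by nia|].
  by move=> i ik; rewrite key // key1 // He'.
Qed.

Lemma vdW_natP (k : nat) : vdW_nat k.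
Proof.
elim: k => [|k IHk] C.
  by exists 1 => c; exists 0, 1; split=> // i; rewrite leqn0 => /eqP->.
have [N HN] := vdW_focus C IHk #|C|.+1; exists N => c.
have [//|[F [ds [_ sds /card_uniqP uds _]]]] := HN c.
by have := max_card (mem [seq c (F - d) | d <- ds]); rewrite uds size_map sds ltnn.
Qed.

Lemma vdW_exists (k r : nat) :
  exists N, forall c : {ffun 'I_N -> 'I_r}, has_mono_AP k c.
Proof.
case: r => [|r]; first by exists 1 => c; case: (c ord0).
have [N HN] := vdW_natP k 'I_r.+1; exists N => c.
pose c' m : 'I_r.+1 := if insub m is Some i then c i else ord0.
have [a [d [d0 _ adN Hc]]] := HN c'.
exists (Posz a.+1), (Posz d), (c' a); split; first by case; lia.
move=> i ik; have iN : a + i * d < N by nia.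
exists (Ordinal iN); first by rewrite /=; lia.
by rewrite -(Hc i (ltnW ik)) /c' insubT.
Qed.

(* Main.v *)
Require Import Defs.
From mathcomp Require Import all_boot all_order all_algebra zify ring lra.

Set Implicit Arguments.
Unset Strict Implicit.
Unset Printing Implicit Defensive.

Import Order.TTheory GRing.Theory Num.Theory.

(* The number of available colours is increased by 3 while the length of the
   coloured interval is multiplied by a prime M of size 3^((1 - o(1)) k).  Such an
   M can be chosen so that Z/M has a 3-colouring c0 without monochromatic k-term
   progressions.  Given an r-colouring c of [N], with N exponential in k, choose a
   prime p <= k of order k and, for each residue v modulo M, a random base-p digit
   g(v).  Colour x = M u + v by c(u) if g(v) is a digit of u, and by c0(v), in
   three new colours, otherwise.  As u has O(k / log k) digits, the first case has
   probability O(1 / log k), so that by the union bound no progression whose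
   difference is prime to M falls entirely under it; hence such a progression
   is not monochromatic in an old colour, nor, by the choice of c0, in a new one.
   If M divides the difference, then v is constant, while the lowest digit of u
   that varies along the progression takes all values, g(v) among them; hence the
   progression is not monochromatic in a new colour, nor, by the choice of c, in an
   old one. *)

Local Open Scope nat_scope.

(** * Primes at all scales *)

Lemma bin_leq_exp2 (n m : nat) : 'C(n, m) <= 2 ^ n.
Proof.
elim: n m => [|n IHn] [|m] //; first by rewrite bin0 expn_gt0.
by rewrite binS expnS mul2n -addnn leq_add.
Qed.

Lemma central_bin_step (m : nat) :
  m.+1 * 'C(m.+1.*2, m.+1) = (m.*2.+1).*2 * 'C(m.*2, m).
Proof.
have e (n : nat) : 'C(n.*2, n) * (n`! * n`!) = (n.*2)`!.
  by have := @bin_fact n.*2 n; rewrite -addnn addnK => -> //; exact: leq_addr.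
have h := e m; have := e m.+1.
rewrite doubleS !factS -{}h.
have : 0 < m`! * m`! by rewrite muln_gt0 fact_gt0.
move: (m`!) 'C(_, m.+1) 'C(_, m) => f X Y f0 h.
apply/eqP; rewrite -(eqn_pmul2l (ltn0Sn m)) -(eqn_pmul2l f0); apply/eqP; lia.
Qed.

Lemma central_bin_lower (m : nat) : 0 < m -> 4 ^ m <= m.*2 * 'C(m.*2, m).
Proof.
case: m => // m _; elim: m => // m IHm.
by have := central_bin_step m.+1; rewrite expnS; nia.
Qed.

(** By Legendre's formula the exponent is the sum over k of [m.*2 %/ p ^ k - 2 * (m %/ p ^ k)]; each
    term is at most 1 and vanishes once [p ^ k] exceeds [m.*2]. *)
Lemma pfactor_central_bin_leq (p m : nat) : prime p -> 0 < m ->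
  p ^ logn p 'C(m.*2, m) <= m.*2.
Proof.
move=> pp m0.
have p1 := prime_gt1 pp.
apply: leq_trans (_ : p ^ trunc_log p m.*2 <= _); last first.
  by rewrite trunc_logP ?double_gt0.
rewrite leq_exp2l //.
have mm : m <= m.*2 by lia.
have eb := bin_fact mm.
have e : logn p 'C(m.*2, m) + (logn p m`!).*2 = logn p (m.*2)`!.
  rewrite -eb; have -> : m.*2 - m = m by lia.
  by rewrite !lognM ?muln_gt0 ?fact_gt0 ?bin_gt0 // addnn.
have ext : \sum_(1 <= k < m.+1) m %/ p ^ k = \sum_(1 <= k < (m.*2).+1) m %/ p ^ k.
  rewrite (@big_cat_nat _ _ _ m.+1 1 (m.*2).+1) //=.
  rewrite -[LHS]addn0; congr (_ + _); rewrite big_nat_cond big1 // => k /andP[/andP[mk _] _].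
  by rewrite divn_small // (leq_trans mk) // ltnW // ltn_expl.
move: e; rewrite !logn_fact // ext -[(\sum_(_ <= _ < _) _).*2]mul2n big_distrr /=.
set t := trunc_log p m.*2.
have -> : \sum_(1 <= k < (m.*2).+1) m.*2 %/ p ^ k =
   \sum_(1 <= k < (m.*2).+1) 2 * (m %/ p ^ k) +
   \sum_(1 <= k < (m.*2).+1) (m.*2 %/ p ^ k - 2 * (m %/ p ^ k)).
  rewrite -big_split /=; apply: eq_bigr => k _; rewrite subnKC //.
  by rewrite -mul2n leq_divRL ?expn_gt0 ?prime_gt0 // -mulnA leq_mul2l /= leq_trunc_div.
rewrite addnC => /addnI ->.
apply: (@leq_trans (\sum_(1 <= k < (m.*2).+1) (k <= t))).
  rewrite !big_nat; apply: leq_sum => k /andP[k0 km].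
  case: (leqP k t) => [_|tk].
    have pk : 0 < p ^ k by rewrite expn_gt0 prime_gt0.
    rewrite leq_subLR -ltnS ltn_divLR //.
    by have := divn_eq m (p ^ k); have := ltn_pmod m pk; nia.
  rewrite divn_small ?sub0n // ltnNge; apply/negP => h.
  by move: (trunc_log_max p1 h); rewrite -/t leqNgt tk.
have: t <= m.*2 by apply: leq_trans (trunc_logP p1 _); rewrite ?double_gt0 // ltnW // ltn_expl.
move=> tm; rewrite (@big_cat_nat _ _ _ t.+1 1) //=.
rewrite [X in _ + X](_ : _ = 0) ?addn0; last first.
  by rewrite big_nat_cond big1 // => k /andP[/andP[tk _] _]; rewrite leqNgt tk.
rewrite (@eq_big_nat _ _ _ _ _ _ (fun=> 1)) => [|k /andP[_]]; last by rewrite ltnS => ->.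
by rewrite sum_nat_const_nat muln1 subSS subn0.
Qed.

Lemma prime_dvdn_fact (p n : nat) : prime p -> (p %| n`!) = (p <= n).
Proof.
move=> pp; apply/idP/idP => [|pn]; last by rewrite dvdn_fact ?prime_gt0.
apply: contraLR; rewrite -ltnNge => np; rewrite -(expn1 p) pfactor_dvdn ?fact_gt0 //.
rewrite -ltnNge logn_fact // big_nat_cond big1 // => k /andP[/andP[k0 _] _].
by rewrite divn_small // (leq_trans np) // -{1}(expn1 p) leq_exp2l // prime_gt1.
Qed.

(** A prime in ]m, 2m] divides (2m)! but not m!, hence divides the central binomial coefficient,
    which is at most 4^m. *)
Lemma primorial_double (m : nat) :
  \prod_(m.+1 <= p < m.*2.+1 | prime p) p <= 4 ^ m.
Proof.
have C0 : 0 < 'C(m.*2, m) by rewrite bin_gt0 -addnn leq_addr.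
pose pi : nat_pred := [pred p | prime p & m < p <= m.*2].
apply: (@leq_trans 'C(m.*2, m)`_pi); last first.
  rewrite (leq_trans (dvdn_leq C0 (dvdn_part _ _))) //.
  by rewrite (leq_trans (bin_leq_exp2 _ _)) // -mul2n expnM.
rewrite (@widen_partn ('C(m.*2, m) + m.*2)) ?leq_addr //.
rewrite (@big_cat_nat _ _ _ m.+1 0) //=; last by lia.
rewrite [X in _ <= _ * X](@big_cat_nat _ _ _ m.*2.+1) //=; [|lia|lia].
rewrite mulnCA; apply: leq_trans (leq_pmulr _ _); last first.
  rewrite muln_gt0; apply/andP; split; apply: prodn_cond_gt0 => p;
    by rewrite inE expn_gt0 => /andP[/prime_gt0 ->].
rewrite big_nat_cond [leqRHS]big_nat_cond.
rewrite (eq_bigl (fun p => (m < p < m.*2.+1) && (p \in pi))); last first.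
  by move=> p; rewrite inE ltnS; case: (m < p <= _); rewrite ?andbT ?andbF.
apply: leq_prod => p /andP[/andP[mp pm]]; rewrite inE => /andP[pp _].
rewrite -{1}(expn1 p) leq_exp2l ?prime_gt1 // -pfactor_dvdn // expn1.
have e := @bin_fact m.*2 m; move: e; rewrite -addnn addnK addnn => e.
have : p %| (m.*2)`! by rewrite prime_dvdn_fact.
rewrite -e ?Euclid_dvdM //; last by lia.
by rewrite !prime_dvdn_fact // leqNgt mp orbb orbF.
Qed.

Lemma primorial_exp2 (j : nat) :
  \prod_(0 <= p < (2 ^ j).+1 | prime p) p <= 4 ^ (2 ^ j).
Proof.
elim: j => [|j IHj]; first by rewrite big_mkcond /= !big_nat_recr //= big_geq.
rewrite (@big_cat_nat _ _ _ (2 ^ j).+1 0) //=; last by rewrite expnS; lia.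
rewrite [2 ^ j.+1]expnS mul2n.
by rewrite -[(2 ^ j).*2 in leqRHS]addnn expnD leq_mul // primorial_double.
Qed.

(* If no prime lies in ]4^(i-1), 4^i] then 'C(4^i, 4^i / 2) is at most the product
   of the primes below 4^(i-1) and of 2^i prime powers below 4^i, which is too
   small. *)
Lemma prime_between_exp4 (i : nat) : 5 <= i ->
  exists2 p, prime p & 4 ^ i.-1 < p <= 4 ^ i.
Proof.
case: i => // i i5; rewrite [_.-1]/=.
have [/existsP[p /andP[pp ip]]|none] :=
  boolP [exists p : 'I_(4 ^ i.+1).+1, prime p && (4 ^ i < p)].
  by exists p => //; rewrite ip -ltnS /= ltn_ord.
have noprime p : p < (4 ^ i.+1).+1 -> prime p -> p <= 4 ^ i.
  move=> pi pp; rewrite leqNgt; apply: contra none => ip.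
  by apply/existsP; exists (Ordinal pi); rewrite /= pp.
exfalso.
pose m := (4 ^ i).*2; have e : m.*2 = 4 ^ i.+1 by rewrite /m expnS; lia.
have m0 : 0 < m by rewrite /m double_gt0 expn_gt0.
have C0 : 0 < 'C(m.*2, m) by rewrite bin_gt0 -addnn leq_addr.
have upper : 'C(m.*2, m) <= (4 ^ i.+1) ^ (2 ^ i.+1).+1 * 4 ^ (4 ^ i).
  rewrite -[leqLHS]partnT // (@widen_partn ('C(m.*2, m) + m.*2)) ?leq_addr //.
  rewrite (@big_cat_nat _ _ _ m.*2.+1 0) //=; last by lia.
  rewrite [X in _ * X](_ : _ = 1) ?muln1; last first.
    rewrite big_nat_cond big1 // => p /andP[/andP[mp _] _].
    rewrite lognE; case: ifP => // /and3P[pp _ pC].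
    suff: p %| (m.*2)`! by rewrite prime_dvdn_fact // leqNgt mp.
    have := @bin_fact m.*2 m; rewrite -addnn addnK addnn => <-; last by lia.
    by rewrite dvdn_mulr.
  (* Here 2m = 4^(i+1), with square root 2^(i+1). A prime up to that root contributes at most 2m,
     recorded in [A]; a larger one occurs to the power at most 1, since its square exceeds 2m, and
     is recorded in [B]. *)
  pose A p := if p <= 2 ^ i.+1 then 4 ^ i.+1 else 1.
  pose B p := if prime p && (p <= 4 ^ i) then p else 1.
  apply: (@leq_trans (\prod_(0 <= p < m.*2.+1) (A p * B p))).
    rewrite (eq_bigl xpredT) // big_nat [leqRHS]big_nat.
    apply: leq_prod => p; rewrite ltnS => /= pm.
    have A1 : 0 < A p by rewrite /A; case: ifP; rewrite ?expn_gt0.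
    have B1 : 0 < B p by rewrite /B; case: ifP => // /andP[/prime_gt0].
    have [pp|npp] := boolP (prime p); last first.
      by rewrite lognE (negPf npp) muln_gt0 A1.
    have le1 := pfactor_central_bin_leq pp m0.
    rewrite /A; case: (leqP p (2 ^ i.+1)) => [pi|ip].
      by rewrite (leq_trans le1) // e leq_pmulr.
    have pi : p <= 4 ^ i by apply: noprime; rewrite // ltnS -e.
    rewrite mul1n /B pp pi /= -[leqRHS]expn1 leq_exp2l ?prime_gt1 //.
    rewrite leqNgt; apply/negP => l2; move: le1; rewrite leqNgt => /negP; apply.
    apply: (@leq_trans (p ^ 2)); last by rewrite leq_exp2l // prime_gt1.
    rewrite e -[4]/(2 ^ 2) -expnM mulnC expnM.
    by rewrite ltn_exp2r.
  rewrite big_split /=; apply: leq_mul.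
    rewrite (@big_cat_nat _ _ _ (2 ^ i.+1).+1 0) //=; last first.
      by rewrite e ltnS leq_exp2r.
    rewrite [X in _ * X](_ : _ = 1) ?muln1; last first.
      by rewrite big_nat_cond big1 // => p /andP[/andP[ip _] _]; rewrite /A leqNgt ip.
    rewrite (@eq_big_nat _ _ _ _ _ _ (fun=> 4 ^ i.+1)) => [|p /andP[_]].
      by rewrite prod_nat_const_nat subn0.
    by rewrite /A ltnS => ->.
  rewrite (@big_cat_nat _ _ _ (4 ^ i).+1 0) //=; last by rewrite e ltnS leq_exp2l.
  rewrite [X in _ * X](_ : _ = 1) ?muln1; last first.
    rewrite big_nat_cond big1 // => p /andP[/andP[ip _] _].
    by rewrite /B leqNgt ip andbF.
  have := primorial_exp2 i.*2; rewrite -mul2n expnM -[2 ^ 2]/4; apply: leq_trans.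
  rewrite [leqRHS]big_mkcond big_nat [leqRHS]big_nat; apply: leq_prod => p.
  by rewrite /B ltnS => /= ->; rewrite andbT.
have lower := central_bin_lower m0.
(* This is what makes the exponents of 4 in [lower] and [upper] incompatible. It fails at i = 3 (72
   against 64) and holds from i = 4 on (170 against 256), hence the threshold 5. *)
have i4 : i.+1 * (2 ^ i.+1 + 2) < 4 ^ i.
  clear -i5; elim: i i5 => // i IHi.
  rewrite leq_eqVlt => /predU1P[[<-] //|i5]; have := IHi i5.
  rewrite !expnS -[4]/(2 * 2) expnMn; move: (2 ^ i) => x; nia.
have : 4 ^ m <= 4 ^ (i.+1 + (i.+1 * (2 ^ i.+1).+1 + 4 ^ i)).
  by rewrite !expnD expnM (leq_trans lower) // leq_mul // -e.
by rewrite leq_exp2l // /m; lia.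
Qed.

(** * Colourings of uniform hypergraphs *)

Definition mono_on (V : finType) (C : eqType) (f : {ffun V -> C}) (e : {set V}) :=
  [forall x in e, forall y in e, f x == f y].

(** All of V is coloured but only the edges inside [S] are constrained, so a vertex outside [S]
    contributes a free factor [t]. All counts thus live in one type, at the price of the factor [t]
    in [card_proper_onS]. *)
Definition proper_on (V I : finType) (t : nat) (e : I -> {set V}) (S : {set V}) :=
  [set f : {ffun V -> 'I_t} | [forall i, (e i \subset S) ==> ~~ mono_on f (e i)]].

(* A colouring in [A] that is constant on [D] and [w] can be recoloured
   arbitrarily on [D]. *)
Lemma card_mono_leq (V : finType) (t : nat) (A : {set {ffun V -> 'I_t}})
    (D : {set V}) (w : V) :
  (forall f g : {ffun V -> 'I_t}, (forall x, x \notin D -> f x = g x) ->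
     f \in A -> g \in A) -> w \notin D ->
  #|[set f in A | [forall x in D, f x == f w]]| * t ^ #|D| <= #|A|.
Proof.
case: t A => [|t] A Aext wD; set B := [set f in A | _].
  by rewrite (_ : B = set0) ?cards0 //; apply/setP => f; case: (f w).
pose h (fg : {ffun V -> 'I_t.+1} * {ffun V -> 'I_t.+1}) :=
  [ffun x => if x \in D then fg.2 x else fg.1 x].
pose Q := [set g in pffun_on (ord0 : 'I_t.+1) D predT].
have cQ : #|Q| = t.+1 ^ #|D| by rewrite cardsE card_pffun_on card_ord.
rewrite -cQ -cardsX -(card_in_imset (f := h)); last first.
  move=> [f g] [f' g'] /setXP[/= fB gQ] /setXP[/= f'B g'Q] /ffunP eq_h.
  have eqg : g = g'.
    apply/ffunP => x; have [xD|xD] := boolP (x \in D).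
      by have := eq_h x; rewrite !ffunE xD.
    have out u : u \in Q -> u x = ord0.
      rewrite /Q inE => /pffun_onP[/supportP supp _]; exact: supp.
    by rewrite !out.
  have off x : x \notin D -> f x = f' x.
    by move=> xD; have := eq_h x; rewrite !ffunE /= (negPf xD).
  congr (_, _) => //; apply/ffunP => x; have [xD|/off //] := boolP (x \in D).
  move: fB f'B; rewrite !inE => /andP[_ /forall_inP fB] /andP[_ /forall_inP f'B].
  by rewrite (eqP (fB x xD)) (eqP (f'B x xD)) off.
apply/subset_leq_card/subsetP => _ /imsetP[[f g] /setXP[/= fB _] ->].
move: fB; rewrite inE => /andP[fA _]; apply: Aext fA => x xD.
by rewrite ffunE (negPf xD).
Qed.

(* Rosenfeld's counting argument, replacing the Lovasz local lemma: a colouring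
   that is proper on S and becomes improper at an edge containing v is determined,
   on that edge, by one further vertex, so that by induction it is one of at most
   [#|proper_on t e S| / (t * b ^ k)]. *)
Lemma card_proper_onS (R : realFieldType) (V I : finType) (t k D : nat)
    (e : I -> {set V}) (b : R) :
  (forall i, #|e i| = k.+2) -> (forall v, #|[set i | v \in e i]| <= D) ->
  (0 < b)%R -> (D%:R <= (t%:R - b) * b ^+ k)%R ->
  forall (S : {set V}) v, v \notin S ->
  (b * #|proper_on t e S|%:R <= t%:R * #|proper_on t e (v |: S)|%:R)%R.
Proof.
move=> cE dE b0 hD S; pose G T : R := (#|proper_on t e T|%:R)%R.
move: {2}#|S|.+1 (ltnSn #|S|) => n; elim: n S => // n IHn S Sn v vS.
have G0 T : (0 <= G T)%R by exact: ler0n.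
have t0 : (0 < t%:R :> R)%R.
  have : (0 <= (t%:R - b) * b ^+ k)%R by apply: le_trans hD; exact: ler0n.
  by rewrite pmulr_lge0 ?exprn_gt0 // subr_ge0; exact: lt_le_trans.
(* Iterated induction hypothesis: releasing the vertices of [T] multiplies the count by at most (t /
   b)^|T|. *)
have IH (T : {set V}) : T \subset S -> (b ^+ #|T| * G (S :\: T) <= t%:R ^+ #|T| * G S)%R.
  move: {2}#|T| (erefl #|T|) => m; elim: m T => [|m IHm] T eT TS.
    by rewrite eT !expr0 !mul1r (eqP (_ : T == set0)) ?setD0 // -cards_eq0 eT.
  have [x xT] : exists x, x \in T by apply/set0Pn; rewrite -cards_eq0 eT.
  have eT' : #|T :\ x| = m by have := cardsD1 x T; rewrite xT eT => -[].
  have := IHm _ eT' (subset_trans (subD1set _ _) TS).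
  have xS := subsetP TS _ xT.
  have -> : S :\: (T :\ x) = x |: (S :\: T).
    apply/setP => y; rewrite !inE negb_and negbK.
    by case: eqVneq => [->|]; rewrite ?xS.
  have ltS : #|S :\: T| < n.
    have: S :\: T \proper S.
      by rewrite properE subsetDl; apply/subsetPn; exists x; rewrite ?inE ?xT.
    by move=> /proper_card; lia.
  have := IHn _ ltS x; rewrite !inE xT => /(_ isT); rewrite -/(G _) -/(G _) eT' eT !exprS.
  move: (G (S :\: T)) (G (x |: _)) (G S) => g1 g2 g3 h1 h2.
  rewrite [(b * _)%R]mulrC -!mulrA; apply: le_trans (_ : b ^+ m * (t%:R * g2) <= _)%R.
    by rewrite ler_wpM2l // exprn_ge0 // ltW.
  by rewrite mulrCA ler_wpM2l // ltW.
pose bad i := [set f in proper_on t e S | (v \in e i) && (e i \subset v |: S) && mono_on f (e i)].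
have badP i : (b ^+ k * t%:R * #|bad i|%:R <= G S)%R.
  have [/andP[vi iS]|no] := boolP ((v \in e i) && (e i \subset v |: S)); last first.
    rewrite (_ : bad i = set0) ?cards0 ?mulr0 //.
    by apply/setP => f; rewrite !inE (negPf no) andbF.
  have [w] : exists w, w \in e i :\ v.
    by apply/set0Pn; rewrite -cards_eq0; have := cardsD1 v (e i); rewrite vi cE; case: #|_|.
  move=> /setD1P[wv wi].
  (* The colour of [w] determines the k + 1 colours on [T], but as [v] is already outside [S], only
     k vertices are released from [S]: this gains a factor t^(k+1) against a loss of (t / b)^k. *)
  pose T := e i :\ w; have vT : v \in T by rewrite !inE eq_sym wv vi.
  have cT : #|T| = k.+1 by have := cardsD1 w (e i); rewrite wi cE => -[].
  have cT' : #|T :\ v| = k by have := cardsD1 v T; rewrite vT cT => -[].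
  have TS : T :\ v \subset S.
    apply/subsetP => x; rewrite !inE => /and3P[xv _ /(subsetP iS)].
    by rewrite !inE (negPf xv).
  have := IH _ TS; rewrite cT'.
  have -> : S :\: (T :\ v) = S :\: T.
    apply/setP => x; rewrite !inE; case: (eqVneq x v) => [->|//].
    by rewrite (negPf vS) !andbF.
  have : #|bad i| * t ^ k.+1 <= #|proper_on t e (S :\: T)|.
    rewrite -cT; apply: leq_trans (@card_mono_leq _ _ _ T w _ _).
    - rewrite leq_mul2r; apply/orP; right; apply/subset_leq_card/subsetP => f.
      rewrite !inE => /andP[/forallP pf /andP[_ /forall_inP mf]].
      apply/andP; split.
        apply/forallP => j; apply/implyP => js; apply: (implyP (pf j)).
        exact: subset_trans js (subsetDl _ _).
      apply/forall_inP => x; rewrite !inE => /andP[_ xi].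
      by have /forall_inP/(_ _ wi) := mf _ xi.
    - move=> f g fg; rewrite !inE => /forallP pf; apply/forallP => j.
      apply/implyP => jS; apply: contra (implyP (pf j) jS) => /forall_inP mg.
      have offT x : x \in e j -> f x = g x.
        by move=> /(subsetP jS); rewrite inE => /andP[xT _]; exact: fg.
      apply/forall_inP => x xj; apply/forall_inP => y yj.
      by rewrite !offT //; have /forall_inP := mg x xj; apply.
    - by rewrite !inE eqxx.
  rewrite -(ler_nat R) natrM natrX -/(G _) exprS => h1 h2.
  have tk : (0 < t%:R ^+ k :> R)%R by rewrite exprn_gt0.
  have bk : (0 < b ^+ k)%R by rewrite exprn_gt0.
  rewrite -(ler_pM2l tk); apply: le_trans h2; rewrite -(ler_pM2l bk) in h1.
  by apply: le_trans h1; rewrite le_eqVlt; apply/orP; left; apply/eqP; ring.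
(* A colouring proper on [S] can fail on [v |: S] only at an edge through [v]. *)
have sum : #|proper_on t e S| <= #|proper_on t e (v |: S)| + \sum_(i in [set i | v \in e i]) #|bad i|.
  apply: leq_trans (_ : #|proper_on t e (v |: S) :|: \bigcup_(i in [set i | v \in e i]) bad i| <= _).
    apply/subset_leq_card/subsetP => f fS; rewrite inE; apply/orP.
    have [fvS|nf] := boolP (f \in proper_on t e (v |: S)); [by left|right].
    move: nf; rewrite inE negb_forall => /existsP[i]; rewrite negb_imply negbK => /andP[iS mf].
    have vi : v \in e i.
      apply/negPn/negP => vi; move: fS; rewrite inE => /forallP/(_ i).
      rewrite mf implybF => /negP; apply; apply/subsetP => x xi.
      have := subsetP iS x xi; rewrite !inE => /predU1P[xv|//].
      by move: vi; rewrite -xv xi.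
    by apply/bigcupP; exists i; rewrite in_set // fS vi iS.
  rewrite (leq_trans (leq_card_setU _ _)) // leq_add2l.
  elim/big_rec2: _ => [|i x y _ h]; first by rewrite cards0.
  by rewrite (leq_trans (leq_card_setU _ _)) // leq_add2l.
have sumR : (b ^+ k * t%:R * G S <= b ^+ k * t%:R * G (v |: S) + D%:R * G S)%R.
  have bt : (0 <= b ^+ k * t%:R)%R by rewrite mulr_ge0 ?exprn_ge0 ?ltW.
  move: sum; rewrite -(ler_nat R) natrD => /(ler_wpM2l bt) /le_trans; apply.
  rewrite mulrDr lerD2l natr_sum mulr_sumr.
  apply: le_trans (ler_sum _ (fun i _ => badP i)) _.
  rewrite sumr_const -[X in (X <= _)%R]mulr_natl ler_wpM2r // ler_nat; exact: dE.
have := ler_wpM2r (G0 S) hD; rewrite -/(G _) -/(G _).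
have bk : (0 < b ^+ k)%R by rewrite exprn_gt0.
move: sumR bk; move: (b ^+ k)%R (G S) (G _) (D%:R)%R => B g1 g2 d h1 B0 h2.
rewrite -(ler_pM2l B0); lra.
Qed.

(** When vertices are added one at a time from the empty set, each step keeps at least the positive
    fraction b / t of the colourings, so some survive on all of V. *)
Lemma hypergraph_colouring (R : realFieldType) (V I : finType) (t k D : nat)
    (e : I -> {set V}) (b : R) :
  (forall i, #|e i| = k.+2) -> (forall v, #|[set i | v \in e i]| <= D) ->
  (0 < b)%R -> (D%:R <= (t%:R - b) * b ^+ k)%R ->
  exists f : {ffun V -> 'I_t}, forall i, ~~ mono_on f (e i).
Proof.
move=> cE dE b0 hD.
have t0 : (0 < t%:R :> R)%R.
  have : (0 <= (t%:R - b) * b ^+ k)%R by apply: le_trans hD; exact: ler0n.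
  by rewrite pmulr_lge0 ?exprn_gt0 // subr_ge0; exact: lt_le_trans.
suff pos (S : {set V}) : 0 < #|proper_on t e S|.
  have := pos [set: V]; rewrite card_gt0 => /set0Pn[f]; rewrite inE => /forallP pf.
  by exists f => i; apply: (implyP (pf i)); exact: subsetT.
move: {2}#|S| (erefl #|S|) => n; elim: n S => [|n IHn] S eS.
  move/eqP: eS; rewrite cards_eq0 => /eqP->.
  apply/card_gt0P; rewrite ltr0n in t0; exists [ffun=> Ordinal t0].
  rewrite inE; apply/forallP => i; apply/implyP; rewrite subset0 -cards_eq0 cE //.
have [x xS] : exists x, x \in S by apply/set0Pn; rewrite -cards_eq0 eS.
have eS' : #|S :\ x| = n by have := cardsD1 x S; rewrite xS eS => -[].
have := card_proper_onS cE dE b0 hD (_ : x \notin S :\ x).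
rewrite !inE eqxx setD1K // => /(_ isT).
rewrite -(ltr_nat R) => h; rewrite -(pmulr_rgt0 _ t0); apply: lt_le_trans h.
by rewrite mulr_gt0 // ltr0n IHn.
Qed.

(** * Random functions and the union bound *)

(* Overwriting [g] by an arbitrary function on the points [x i] is injective if
   the old values are recorded. *)
Lemma card_hits_leq (V C : finType) (k n : nat) (x : 'I_k -> V) (B : 'I_k -> {set C}) :
  injective x -> (forall i, #|B i| <= n) ->
  #|[set g : {ffun V -> C} | [forall i, g (x i) \in B i]]| * #|C| ^ k
    <= n ^ k * #|C| ^ #|V|.
Proof.
move=> injx cB; set A := [set g | _].
pose over (g : {ffun V -> C}) (u : {ffun 'I_k -> C}) : {ffun V -> C} :=
  [ffun y => if [pick i | x i == y] is Some i then u i else g y].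
have overx g u i : over g u (x i) = u i.
  by rewrite ffunE; case: pickP => [j /eqP/injx->|/(_ i)/eqP].
have overN g u y : (forall i, x i != y) -> over g u y = g y.
  by move=> yx; rewrite ffunE; case: pickP => // i; rewrite (negPf (yx i)).
pose h (gu : {ffun V -> C} * {ffun 'I_k -> C}) :=
  ([ffun i => gu.1 (x i)] : {ffun 'I_k -> C}, over gu.1 gu.2).
pose F := [set u : {ffun 'I_k -> C} in family (fun i => mem (B i))].
have cF : #|F| <= n ^ k.
  rewrite cardsE card_family foldrE big_map big_enum /=.
  apply: leq_trans (leq_prod (fun i _ => cB i)) _.
  by rewrite prod_nat_const card_ord.
have <- : #|[set: {ffun 'I_k -> C}]| = #|C| ^ k by rewrite cardsT card_ffun card_ord.
rewrite -cardsX -(card_in_imset (f := h)); last first.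
  move=> [g u] [g' u'] _ _ [/ffunP eg /ffunP eo].
  congr (_, _); apply/ffunP => y.
    have [i /eqP<-|noi] := pickP (fun i => x i == y).
      by have := eg i; rewrite !ffunE.
    by have := eo y; rewrite !overN // => i; rewrite noi.
  by have := eo (x y); rewrite !overx.
apply: leq_trans (_ : #|setX F [set: {ffun V -> C}]| <= _).
  apply/subset_leq_card/subsetP => _ /imsetP[[g u] /setXP[/= gA _] ->].
  apply/setXP; split; rewrite /F !in_set //=; apply/familyP => i; rewrite ffunE.
  by move: gA; rewrite inE => /forallP.
by rewrite cardsX cardsT card_ffun leq_mul2r cF orbT.
Qed.

(** For each [j], a random [g] hits all the sets [B j i] with probability at most (n / |C|)^k; these
    probabilities sum to less than 1. *)
Lemma exists_avoiding (V C J : finType) (k n : nat) (x : J -> 'I_k -> V)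
    (B : J -> 'I_k -> {set C}) :
  0 < #|C| -> (forall j, injective (x j)) -> (forall j i, #|B j i| <= n) ->
  #|J| * n ^ k < #|C| ^ k ->
  exists g : {ffun V -> C}, forall j, exists i, g (x j i) \notin B j i.
Proof.
move=> C0 injx cB lt.
pose A j := [set g : {ffun V -> C} | [forall i, g (x j i) \in B j i]].
have [/existsP[g gA]|none] := boolP [exists g, [forall j, g \notin A j]].
  exists g => j; have := forallP gA j.
  by rewrite inE negb_forall => /existsP[i]; exists i.
exfalso; move: lt; rewrite ltnNge => /negP; apply.
have F0 : 0 < #|{ffun V -> C}| by rewrite card_ffun expn_gt0 C0.
rewrite -(leq_pmul2r F0).
have : #|[set: {ffun V -> C}]| <= \sum_j #|A j|.
  apply: leq_trans (_ : #|\bigcup_j A j| <= _).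
    apply/subset_leq_card/subsetP => g _; move: none; rewrite negb_exists.
    move=> /forallP/(_ g); rewrite negb_forall => /existsP[j]; rewrite negbK => gj.
    by apply/bigcupP; exists j.
  elim/big_rec2: _ => [|j a b _ h]; first by rewrite cards0.
  by rewrite (leq_trans (leq_card_setU _ _)) // leq_add2l.
rewrite cardsT => h; rewrite mulnC.
apply: leq_trans (leq_mul h (leqnn _)) _; rewrite big_distrl /=.
apply: (@leq_trans (\sum_(j : J) n ^ k * #|C| ^ #|V|)).
  by apply: leq_sum => j _; exact: card_hits_leq.
by rewrite sum_nat_const card_ffun mulnA.
Qed.

(** * Colourings without monochromatic progressions *)

(* Colourings of {0, ..., N - 1}; the values of [c] from [N] on are irrelevant. *)
Definition ap_free (r N k : nat) (c : nat -> nat) : Prop :=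
  (forall x, c x < r) /\
  forall a d col, 0 < d -> ~ (forall i, i < k -> a + i * d < N /\ c (a + i * d) = col).

(** Differences divisible by M are excluded because such progressions are constant modulo M, hence
    monochromatic under any colouring. *)
Definition cyclic_ap_free (t M k : nat) (c : nat -> nat) : Prop :=
  (forall x, c x < t) /\
  forall a d col, ~~ (M %| d) -> ~ (forall i, i < k -> c ((a + i * d) %% M) = col).

Lemma modn_ap_inj (p a d i j : nat) : prime p -> ~~ (p %| d) -> i < p -> j < p ->
  (a + i * d) %% p = (a + j * d) %% p -> i = j.
Proof.
move=> pp pd; wlog ij : i j / i <= j => [H|] ip jp.
  by case: (leqP i j) => [ij|/ltnW ji] e; [exact: H|rewrite [RHS](H j i)].
move/eqP; rewrite eqn_modDl eq_sym eqn_mod_dvd ?leq_mul2r ?ij ?orbT // -mulnBl.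
rewrite Euclid_dvdM // (negPf pd) orbF => /dvdnP[[|q] e]; first by lia.
by nia.
Qed.

(** The progressions of nonzero difference form a uniform hypergraph on Z/M, their terms being
    distinct as M is prime. A point lies on at most one of them for each difference and position,
    which bounds the degree. *)
Lemma exists_cyclic_ap_free (R : realFieldType) (t M k : nat) (b : R) :
  prime M -> k.+2 <= M -> (0 < b)%R ->
  ((M * k.+2)%:R <= (t%:R - b) * b ^+ k)%R ->
  exists c, cyclic_ap_free t M k.+2 c.
Proof.
case: M => // m pM kM b0 hD.
pose pt (a d i : nat) : 'I_m.+1 := inZp (a + i * d).
pose e (ad : 'I_m.+1 * 'I_m) := [set pt ad.1 ad.2.+1 i | i : 'I_k.+2].
have ndvd d : d < m -> ~~ (m.+1 %| d.+1).
  by move=> dm; apply/negP => /dvdn_leq; lia.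
have cE ad : #|e ad| = k.+2.
  rewrite card_imset ?card_ord // => i j /(congr1 val) /= eij; apply: val_inj.
  apply: modn_ap_inj eij => //; first exact: ndvd.
    exact: leq_trans (ltn_ord i) kM.
  exact: leq_trans (ltn_ord j) kM.
have dE v : #|[set ad | v \in e ad]| <= m.+1 * k.+2.
  (* The start is recovered as v - j (d + 1) modulo M; [dj.1.+1] keeps the difference nonzero. *)
  pose f (dj : 'I_m * 'I_k.+2) : 'I_m.+1 * 'I_m :=
    (inZp (v + (m.+1 - (dj.2 * dj.1.+1) %% m.+1)), dj.1).
  apply: leq_trans (_ : #|f @: [set: 'I_m * 'I_k.+2]| <= _).
    apply/subset_leq_card/subsetP => -[a d]; rewrite inE => /imsetP[j _ ev].
    apply/imsetP; exists (d, j); rewrite ?inE // /f /=; congr (_, _).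
    apply: val_inj; rewrite /= ev /= modnDml /=.
    set w := j * d.+1; have := ltn_pmod w (ltn0Sn m) => wm.
    have -> : a + w + (m.+1 - w %% m.+1) = (w %/ m.+1).+1 * m.+1 + a.
      by have := divn_eq w m.+1; lia.
    by rewrite modnMDl modn_small.
  rewrite (leq_trans (leq_imset_card _ _)) // cardsT card_prod !card_ord.
  by rewrite leq_mul2r leqnSn orbT.
have [f fP] := hypergraph_colouring cE dE b0 hD.
exists (fun x => f (inZp x)); split=> // a d col nd H.
pose d' := (d %% m.+1).-1.
have d'S : d'.+1 = d %% m.+1 by rewrite /d' prednK // lt0n.
have d'm : d' < m by have := ltn_pmod d (ltn0Sn m); lia.
apply/negP: (fP (inZp a, Ordinal d'm)); rewrite negbK.
have val_f i : i < k.+2 -> f (pt (inZp a : 'I_m.+1) d'.+1 i) = col :> nat.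
  move=> ik; rewrite -(H i ik); congr (nat_of_ord (f _)); apply: val_inj => /=.
  by rewrite modn_mod d'S modnDml -modnDmr modnMmr modnDmr.
apply/forall_inP => _ /imsetP[i _ ->]; apply/forall_inP => _ /imsetP[j _ ->].
by apply/eqP/val_inj; rewrite /= !val_f.
Qed.

(* [l] is the [p]-adic valuation of [d]: the digits below position [l] are
   constant along the progression, and the digit at [l] runs through all
   residues. *)
Lemma ap_digit_hit (p n u d w : nat) : prime p -> 0 < d -> d < p ^ n -> w < p ->
  exists l i, [/\ l < n, i < p & ((u + i * d) %/ p ^ l) %% p = w].
Proof.
move=> pp d0 dn wp; set l := logn p d.
have [e pe de] := pfactor_coprime pp d0; rewrite -/l in de.
have npe : ~~ (p %| e) by rewrite -prime_coprime.
have p0 := prime_gt0 pp.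
pose f (i : 'I_p) : 'I_p := Ordinal (ltn_pmod (u %/ p ^ l + i * e) p0).
have injf : injective f.
  by move=> i j [eij]; apply: val_inj; apply: modn_ap_inj eij.
have /codomP[i /(congr1 val) /= ei] := injF_onto injf (Ordinal wp).
exists l, i; split=> //.
  rewrite -(ltn_exp2l _ _ (prime_gt1 pp)); apply: leq_ltn_trans dn.
  by apply: dvdn_leq => //; exact: pfactor_dvdnn.
by rewrite de mulnA addnC divnMDl ?expn_gt0 ?p0 // addnC -ei.
Qed.

(* The residue class of x = M u + v modulo M passes x on to the colouring [c] of u
   when one of the digits of u is [g v]. *)
Lemma ap_free_step (r t M N p n k : nat) (c c0 : nat -> nat) :
  prime M -> k <= M -> prime p -> p <= k -> N <= p ^ n ->
  (M * N) ^ 2 * n ^ k < p ^ k ->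
  ap_free r N k c -> cyclic_ap_free t M k c0 ->
  exists c', ap_free (r + t) (M * N) k c'.
Proof.
case: M => // m; set M := m.+1; case: p => // q; set p := q.+1.
move=> pM kM pp pk Npn small [cr cP] [c0t c0P].
have k2 : 1 < k := leq_trans (prime_gt1 pp) pk.
pose digit (u l : nat) : 'I_p := inZp (u %/ p ^ l).
(* Data for the union bound: [J] lists the progressions of difference prime to M, [x j i] is the
   residue of a term and [B j i] the set of digits of its quotient. *)
pose J : finType := {ad : 'I_(M * N) * 'I_(M * N) | ~~ (M %| ad.2)}.
pose x (j : J) (i : 'I_k) : 'I_M := inZp ((val j).1 + i * (val j).2).
pose B (j : J) (i : 'I_k) : {set 'I_p} :=
  [set digit (((val j).1 + i * (val j).2) %/ M) l | l : 'I_n].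
have xinj j : injective (x j).
  move=> i i' /(congr1 val) /= ei; apply: val_inj.
  apply: modn_ap_inj ei; rewrite ?(valP j) //.
    exact: leq_trans (ltn_ord i) kM.
  exact: leq_trans (ltn_ord i') kM.
have cB j i : #|B j i| <= n by rewrite (leq_trans (leq_imset_card _ _)) // card_ord.
have cJ : #|J| * n ^ k < #|'I_p| ^ k.
  rewrite card_ord; apply: leq_ltn_trans small; rewrite leq_mul2r.
  rewrite card_sub; apply/orP; right; apply: leq_trans (max_card _) _.
  by rewrite card_prod card_ord.
have p0 : 0 < #|'I_p| by rewrite card_ord.
have [g gP] := exists_avoiding p0 xinj cB cJ.
pose pass y := [exists l : 'I_n, digit (y %/ M) l == g (inZp y)].
exists (fun y => if pass y then c (y %/ M) else r + c0 (y %% M)); split=> [y|].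
  by case: ifP => _; [rewrite ltn_addr|rewrite ltn_add2l].
move=> a d col d0 H.
have aL : a + 1 * d < M * N by have [] := H 1 k2.
(* The colour alone tells which rule was applied: values below [r] come from [c], the others from
   [c0]. *)
have all_pass i : col < r -> i < k -> pass (a + i * d).
  by move=> cr' ik; have [_] := H i ik; case: ifP => // _; lia.
have no_pass i : r <= col -> i < k -> ~~ pass (a + i * d).
  move=> cr' ik; have [_] := H i ik; case: ifP => // _.
  by have := cr ((a + i * d) %/ M); lia.
have [/dvdnP[d' ed]|nd] := boolP (M %| d); last first.
  have [colr|colr] := ltnP col r; last first.
    apply: (c0P a d (col - r) nd) => i ik.
    by have [_] := H i ik; rewrite (negPf (no_pass i colr ik)); lia.
  have aL' : a < M * N by lia.
  have dL' : d < M * N by lia.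
  have [i] := gP (exist _ (Ordinal aL', Ordinal dL') nd).
  have /existsP[l /eqP el] := all_pass i colr (ltn_ord i).
  by move=> /imsetP[]; exists l.
have quo i : (a + i * d) %/ M = a %/ M + i * d'.
  by rewrite ed mulnA addnC divnMDl // addnC.
have res i : inZp (a + i * d) = inZp a :> 'I_M.
  apply: val_inj; rewrite /= ed mulnA addnC; exact: modnMDl.
have quoN i : i < k -> a %/ M + i * d' < N.
  by move=> ik; rewrite -quo ltn_divLR // [N * M]mulnC; have [] := H i ik.
have d'0 : 0 < d' by case: (d') ed => // ed; rewrite ed in d0.
have [colr|colr] := ltnP col r.
  apply: (cP (a %/ M) d' col d'0) => i ik; split; first exact: quoN.
  by have [_] := H i ik; rewrite (all_pass i colr ik) quo.
have d'n : d' < p ^ n.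
  by apply: leq_trans Npn; apply: leq_ltn_trans (quoN 1 k2); rewrite mul1n leq_addl.
(* Every term has the residue of [a], hence the same required digit; it shows up in the quotient of
   one of the first p terms, and [p <= k]. *)
have [l [i [ln ip e]]] := ap_digit_hit (a %/ M) pp d'0 d'n (ltn_ord (g (inZp a))).
have /negP := no_pass i colr (leq_trans ip pk); apply.
apply/existsP; exists (Ordinal ln); rewrite /= quo res; apply/eqP/val_inj.
exact: e.
Qed.

From mathcomp Require Import all_classical all_reals all_analysis.

Import Order.TTheory GRing.Theory Num.Theory.
Local Open Scope ring_scope.

(** * Asymptotic choice of the parameters *)

(** With 4^i <= n < 4^(i+1), a prime in ]4^(i-1), 4^i] is within a factor 16 of n. *)
Lemma prime_below (n : nat) : (4 ^ 5 <= n)%N ->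
  exists2 p, prime p & (p <= n < 16 * p)%N.
Proof.
move=> n5; set i := trunc_log 4 n.
have n0 : (0 < n)%N by apply: leq_trans n5; rewrite expn_gt0.
have i5 : (5 <= i)%N by apply: trunc_log_max.
have [p pp /andP[lp up]] := prime_between_exp4 i5.
exists p => //; rewrite (leq_trans up) ?trunc_logP //=.
apply: leq_trans (trunc_log_ltn n (isT : (1 < 4)%N)) _; rewrite -/i.
by case: (i) i5 lp => // j _ /= lp; rewrite !expnS; lia.
Qed.

Lemma exp_dominates_square (R : realType) (x C : R) : 0 < x ->
  exists K : nat, forall k : nat, (K <= k)%N -> C * k.+2%:R ^+ 2 <= expR (x * k%:R).
Proof.
(* The cubic term of the exponential suffices: 54 = 3! * 3^2, where 3^2 comes from k + 2 <= 3k. *)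
move=> x0; exists (Num.trunc (54 * `|C| / x ^+ 3)).+1 => k Kk.
have k1 : 1 <= k%:R :> R by rewrite ler1n; exact: leq_trans Kk.
have x3 : 0 < x ^+ 3 by rewrite exprn_gt0.
have hC : 54 * `|C| <= x ^+ 3 * k%:R.
  rewrite -ler_pdivrMl // mulrC ltW //.
  have z0 : 0 <= 54 * `|C| / x ^+ 3 by rewrite divr_ge0 ?mulr_ge0 // ltW.
  have /andP[_ h] := truncn_itv z0.
  by apply: lt_le_trans h _; rewrite ler_nat.
apply: le_trans (_ : `|C| * k.+2%:R ^+ 2 <= _).
  by rewrite ler_wpM2r ?ler_norm // exprn_ge0.
have xk : 0 <= x * k%:R by rewrite mulr_ge0 // ltW.
apply: le_trans (expR_ge1Dxn 2 xk).
have -> : 3`!%:R = 6 :> R by [].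
rewrite exprMn -[k.+2]addn2 natrD; move: (k%:R) k1 hC => y y1.
move: (x ^+ 3) (`|C|) (normr_ge0 C) => z c c0 hC.
have h1 : c * (y + 2) ^+ 2 <= c * (3 * y) ^+ 2.
  by rewrite ler_wpM2l // ler_sqr ?nnegrE; lra.
have h2 : 54 * c * y ^+ 2 <= z * y * y ^+ 2 by rewrite ler_wpM2r // sqr_ge0.
have -> : z * y ^+ 3 / 6 = (z * y * y ^+ 2) / 6 by field.
apply: le_trans h1 _; lra.
Qed.

(** With [b] = t^(1 - eta/2), the largest size [X] that the degree condition allows beats t^((1 -
    eta) k) by an exponential factor. This absorbs [s], the polynomial in k and the 16 lost in
    passing to a prime below [X]. *)
Lemma cyclic_ap_free_asymp (R : realType) (t : nat) (eta : R) :
  (2 <= t <= 4)%N -> 0 < eta -> eta <= 1 / 2 ->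
  exists K : nat, forall k : nat, (K < k)%N -> exists M c,
    [/\ prime M, (k <= M)%N, (M <= 4 ^ k)%N,
        expR ((1 - eta) * ln t%:R * k%:R) <= M%:R & cyclic_ap_free t M k c].
Proof.
move=> /andP[t2 t4] e0 e1; set L := ln t%:R.
have tp : 0 < t%:R :> R by rewrite ltr0n; lia.
have L0 : 0 < L by rewrite ln_gt0 // ltr1n.
have tE : t%:R = expR L by rewrite lnK ?posrE.
pose b := expR ((1 - eta / 2) * L).
have b0 : 0 < b by exact: expR_gt0.
have bt : b < t%:R by rewrite tE ltr_expR; nra.
pose s := t%:R - b; have s0 : 0 < s by rewrite subr_gt0.
have xb : 0 < (1 - eta / 2) * L by rewrite mulr_gt0 //; lra.
have xr : 0 < eta / 2 * L by rewrite mulr_gt0 //; lra.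
have [K1 HK1] := exp_dominates_square (16 / s) xb.
have [K2 HK2] := exp_dominates_square (16 / s * expR ((1 - eta) * L * 2)) xr.
exists (K1 + K2 + 100)%N => -[//|[|k]] Kk; first by clear -Kk; lia.
have [k1 k2 k3] : [/\ (K1 <= k)%N, (K2 <= k)%N & (64 <= k.+2)%N].
  by clear -Kk; split; lia.
have {}HK1 := HK1 k k1; have {}HK2 := HK2 k k2.
pose X := s * b ^+ k / k.+2%:R.
have bk : b ^+ k = expR ((1 - eta / 2) * L * k%:R) by rewrite expRM_natr.
have k20 : 0 < k.+2%:R :> R by rewrite ltr0n.
have X0 : 0 <= X by rewrite divr_ge0 ?mulr_ge0 ?exprn_ge0 // ltW.
have X1 : 16 * k.+2%:R <= X.
  have := ler_wpM2l (ltW s0) HK1; rewrite -bk => h; rewrite ler_pdivlMr //.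
  by apply: le_trans h; rewrite le_eqVlt; apply/orP; left; apply/eqP; field; lra.
have X2 : 16 * expR ((1 - eta) * L * k.+2%:R) <= X.
  pose E1 := expR ((1 - eta) * L * k%:R).
  pose E2 := expR ((1 - eta) * L * 2).
  have eb : b ^+ k = E1 * expR (eta / 2 * L * k%:R).
    by rewrite bk -expRD; congr expR; field.
  have -> : expR ((1 - eta) * L * k.+2%:R) = E1 * E2.
    by rewrite -expRD; congr expR; rewrite -[k.+2]addn2 natrD; ring.
  have E10 : 0 < E1 by exact: expR_gt0.
  have E20 : 0 < E2 by exact: expR_gt0.
  have sE : 0 <= s * E1 by rewrite mulr_ge0 // ltW.
  have := ler_wpM2l sE HK2; rewrite -[X in _ <= X]mulrA -eb -/E2 => h; rewrite ler_pdivlMr //.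
  apply: le_trans (_ : 16 * (E1 * E2) * k.+2%:R * k.+2%:R <= _).
    by rewrite ler_peMr ?ler1n // mulr_ge0 ?mulr_ge0 // ltW.
  by apply: le_trans h; rewrite le_eqVlt; apply/orP; left; apply/eqP; field; lra.
have [M pM /andP[MX XM]] : exists2 p, prime p & (p <= Num.trunc X < 16 * p)%N.
  apply: prime_below; rewrite truncn_ge_nat //; apply: le_trans X1.
  (* 16 * 64 is 4^5, the threshold of [prime_below]. *)
  by rewrite -natrM ler_nat (@leq_trans (16 * 64)) // leq_mul2l.
have XM' : X < 16 * M%:R.
  by rewrite -natrM -truncn_lt_nat.
have MX' : M%:R <= X by rewrite -truncn_ge_nat.
have kM : (k.+2 <= M)%N by rewrite -(ler_nat R); lra.
have cond : (M * k.+2)%:R <= (t%:R - b) * b ^+ k.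
  by rewrite natrM -ler_pdivlMr.
have [c cP] := exists_cyclic_ap_free pM kM b0 cond.
exists M, c; split=> //; last by lra.
rewrite -(ler_nat R); apply: le_trans MX' _.
apply: le_trans (_ : s * b ^+ k <= _).
  by rewrite ler_pdivrMr // ler_peMr ?ler1n // mulr_ge0 ?exprn_ge0 // ltW.
have t4' : t%:R <= 4 :> R by rewrite ler_nat.
apply: le_trans (_ : 4 * 4 ^+ k <= _).
  apply: ler_pM; [exact: ltW|exact/exprn_ge0/ltW|rewrite /s; lra|].
  by rewrite lerXn2r ?nnegrE //; lra.
by rewrite natrX !exprS; have := exprn_ge0 k (ler0n R 4); lra.
Qed.

(** About p / B digits are few enough for the union bound, yet 2 B n >= p, so that p >= B^(2B) gives
    p^n >= B^(2 B n) >= B^p. *)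
Lemma enough_digits (B : nat) : (0 < B)%N -> exists P0 : nat, forall p : nat,
  (P0 <= p)%N -> exists n, (B * n < p)%N /\ (B ^ p <= p ^ n)%N.
Proof.
move=> B0; exists (B ^ (2 * B) + B + 1)%N => p hp; exists (p.-1 %/ B)%N.
have hn := divn_eq p.-1 B; have hr := ltn_pmod p.-1 B0.
have n0 : (0 < p.-1 %/ B)%N by rewrite divn_gt0 //; lia.
move: (p.-1 %/ B)%N n0 hn => n n0 hn; split; first by lia.
apply: (@leq_trans ((B ^ (2 * B)) ^ n)%N); last first.
  by rewrite leq_exp2r //; lia.
rewrite -expnM leq_pexp2l //; nia.
Qed.

(** The upper bound on [N] is carried through the induction to control the number of digits at the
    next step. *)
Lemma ap_free_asymp (R : realType) (a b : nat) (eta : R) :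
  (2 <= a <= 4)%N -> 0 < eta -> eta <= 1 / 2 ->
  exists K : nat, forall k : nat, (K < k)%N -> exists N c,
    [/\ (N <= 4 ^ (b.+1 * k))%N,
        expR ((1 - eta) * ln (a * 3 ^ b)%:R * k%:R) <= N%:R
      & ap_free (a + 3 * b) N k c].
Proof.
move=> ha e0 e1; elim: b => [|b [K1 IH]].
  have [K HK] := cyclic_ap_free_asymp ha e0 e1.
  exists K.+1 => k Kk; have [M [c [pM kM M4 lbM [ct cP]]]] := HK k (ltnW Kk).
  exists M, c; rewrite mul1n muln1 muln0 addn0; split=> //; split=> // x d col d0 H.
  have k2 : (1 < k)%N by lia.
  (* The second term lies below M, so 0 < d < M and M does not divide d. *)
  have [xd _] := H 1%N k2.
  apply: (cP x d col) => [|i ik]; first by apply/negP => /dvdn_leq; lia.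
  by have [lt <-] := H i ik; rewrite modn_small.
have [K2 H3] := @cyclic_ap_free_asymp R 3 eta isT e0 e1.
(* Large enough for two purposes: as k < 16 p, it gives N <= B^p, so that n digits suffice, and (M
   N)^2 <= B^k, so that B n < p yields the union bound. *)
pose B := (4 ^ (32 * b.+2))%N.
have B0 : (0 < B)%N by rewrite expn_gt0.
have [P0 HP] := enough_digits B0.
exists (K1 + K2 + 16 * P0 + 4 ^ 5)%N => k Kk.
have [N [c [N4 lbN cP]]] := IH k ltac:(lia).
have [M [c0 [pM kM M4 lbM c0P]]] := H3 k ltac:(lia).
have [p pp /andP[pk kp]] := @prime_below k ltac:(lia).
have [n [np Bn]] := HP p ltac:(lia).
have pn : (N <= p ^ n)%N.
  apply: leq_trans N4 (leq_trans _ Bn).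
  rewrite /B -!expnM leq_exp2l //; nia.
have MN4 : (M * N <= 4 ^ (b.+2 * k))%N by rewrite mulSn expnD leq_mul.
have small : ((M * N) ^ 2 * n ^ k < p ^ k)%N.
  have k0 : (0 < k)%N by lia.
  apply: leq_ltn_trans (_ : (B * n) ^ k < _)%N; last by rewrite ltn_exp2r.
  rewrite [leqRHS]expnMn leq_mul2r; apply/orP; right.
  apply: (@leq_trans ((4 ^ (b.+2 * k)) ^ 2)%N); first by rewrite leq_exp2r.
  rewrite /B -!expnM leq_exp2l //; nia.
have [c' c'P] := ap_free_step pM kM pp pk pn small cP c0P.
exists (M * N)%N, c'; split=> //; last first.
  by rewrite mulnS [(3 + _)%N]addnC addnA.
have a0 : (0 < a * 3 ^ b)%N by rewrite muln_gt0 expn_gt0; lia.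
rewrite expnS mulnCA natrM [(M * N)%:R]natrM lnM ?posrE ?ltr0n //.
rewrite mulrDr mulrDl expRD ler_pM ?expR_ge0 //.
Qed.

(** * Transfer to van der Waerden numbers and their inverse *)

(* A progression with negative difference is read from its other end. *)
Lemma has_mono_AP_nat (r N k : nat) (c : {ffun 'I_N -> 'I_r}) :
  (0 < k)%N -> has_mono_AP k c ->
  exists (a d : nat) (col : 'I_r), (0 < d)%N /\
    forall i, (i < k)%N -> exists2 y : 'I_N, y = (a + i * d)%N :> nat & c y = col.
Proof.
move=> k0 [x [d [col [d0 H]]]].
have [y0 ey0 _] := H 0%N k0; rewrite mul0r addr0 in ey0.
have kk : (k.-1 < k)%N by rewrite prednK.
have [y1 ey1 _] := H k.-1 kk.
case: d d0 H ey1 => d d0 H ey1.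
  exists y0, d, col; split; first by move: d0; clear; lia.
  move=> i ik; have [y ey cy] := H i ik; exists y => //.
  by move: ey ey0; clear; nia.
exists y1, d.+1, col; split=> // i ik.
have ki : (k.-1 - i < k)%N by move: k0; clear; lia.
have [y ey cy] := H _ ki; exists y => //.
have : (k.-1 - i)%N%:Z = k.-1%:Z - i%:Z by move: ik; clear; lia.
by move: ey ey1; move: (k.-1 - i)%N => j; rewrite NegzE; clear; nia.
Qed.

Lemma vdW_gt (r N k : nat) (c : nat -> nat) :
  (0 < k)%N -> ap_free r N k c -> (N < vdW k r)%N.
Proof.
move=> k0 [cr cP]; rewrite ltnNge; apply/negP => WN.
have [/(_ [ffun y : 'I_(vdW k r) => Ordinal (cr y)]) H _] := leastP (vdW_exists k r).
have [a [d [col [d0 ap]]]] := has_mono_AP_nat k0 H.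
apply: (cP a d col d0) => i /ap[y ey]; rewrite ffunE => <-; rewrite -ey; split=> //.
exact: leq_trans (ltn_ord y) WN.
Qed.

Lemma vdW_inv_leq (r N k : nat) : (0 < r)%N -> (N < vdW k r)%N -> (vdW_inv r N <= k)%N.
Proof.
move=> r0 NW; have [_ min_inv] := leastP (vdW_inv_exists N r0).
apply: min_inv; apply/existsNP => H.
by have [_ /(_ N H)] := leastP (vdW_exists k r); rewrite leqNgt NW.
Qed.

Theorem theorem1 (R : realType) :
  (forall r a b : nat, (2 <= r)%N -> r = (a + 3 * b)%N ->
     a \in [:: 2; 3; 4]%N ->
     forall eta : R, 0 < eta ->
     exists K : nat, forall k : nat, (K < k)%N ->
       (a * 3 ^ b)%:R `^ ((1 - eta) * k%:R) < (vdW k r)%:R :> R)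
  /\
  (exists C : R, 0 < C /\
     forall r : nat, (2 <= r)%N ->
     exists D : R, forall N : nat, (1 <= N)%N ->
       (vdW_inv r N)%:R <= C * (ln N%:R / r%:R) + D).
Proof.
have lower : forall r a b : nat, (2 <= r)%N -> r = (a + 3 * b)%N ->
     a \in [:: 2; 3; 4]%N ->
     forall eta : R, 0 < eta ->
     exists K : nat, forall k : nat, (K < k)%N ->
       (a * 3 ^ b)%:R `^ ((1 - eta) * k%:R) < (vdW k r)%:R :> R.
  move=> r a b _ -> ha eta e0.
  have ha' : (2 <= a <= 4)%N by move: ha; rewrite !inE => /or3P[] /eqP->.
  (* A smaller eta only strengthens the bound, the base being at least 1. *)
  pose eta' := Num.min eta (1 / 2).
  have e'0 : 0 < eta' by rewrite lt_min e0 divr_gt0.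
  have e'1 : eta' <= 1 / 2 by rewrite ge_min lexx orbT.
  have e'e : eta' <= eta by rewrite ge_min lexx.
  have [K HK] := ap_free_asymp b ha' e'0 e'1.
  exists K => k Kk; have [N [c [_ lbN cP]]] := HK k Kk.
  have k0 : (0 < k)%N by exact: leq_ltn_trans Kk.
  have W1 : 1 <= (a * 3 ^ b)%:R :> R.
    by rewrite ler1n muln_gt0 expn_gt0 andbT; case/andP: ha' => /ltnW.
  apply: le_lt_trans (_ : N%:R < _); last by rewrite ltr_nat; exact: vdW_gt cP.
  apply: le_trans lbN; rewrite /powR gt_eqF ?(lt_le_trans _ W1) //.
  rewrite ler_expR mulrAC; apply: ler_wpM2r => //; apply: ler_wpM2r; [exact: ln_ge0|lra].
split=> //.
have ln2 : 0 < ln 2 :> R by rewrite ln_gt0 // ltr1n.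
(* With eta = 1/2 and ln (a 3^b) >= (ln 2 / 4) r, the lower bound exceeds N as soon as k (ln 2 / 8)
   r >= ln N. *)
exists (8 / ln 2); split=> [|r r2]; first by rewrite divr_gt0.
pose a := (2 + (r - 2) %% 3)%N; pose b := ((r - 2) %/ 3)%N.
have er : r = (a + 3 * b)%N by rewrite /a /b; move: r2; clear; lia.
have ha : a \in [:: 2; 3; 4]%N.
  by rewrite /a; have := ltn_pmod (r - 2) (isT : (0 < 3)%N); case: (_ %% _)%N => [|[|[|]]].
have half0 : 0 < 1 / 2 :> R by lra.
have [K HK] := lower r a b r2 er ha (1 / 2) half0.
exists (K.+2%:R) => N N1.
have lnN0 : 0 <= ln N%:R :> R by rewrite ln_ge0 // ler1n.
have r0 : 0 < r%:R :> R by rewrite ltr0n; exact: leq_trans r2.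
pose z : R := 8 / ln 2 * (ln N%:R / r%:R).
have z0 : 0 <= z by rewrite mulr_ge0 ?divr_ge0 // ltW.
have /andP[zl zu] := truncn_itv z0.
(* The shift puts [k] above both [K] and [z], while keeping it at most [z] plus the constant D. *)
pose k := (Num.trunc z + K.+2)%N.
apply: le_trans (_ : k%:R <= _); last by rewrite natrD lerD2r.
rewrite ler_nat vdW_inv_leq //; first exact: leq_trans r2.
have Kk : (K < k)%N by rewrite /k addnS ltnS; apply: leq_trans (leq_addl _ _).
rewrite -(ltr_nat R); apply: le_lt_trans (HK k Kk).
have A0 : (0 < a * 3 ^ b)%N by rewrite muln_gt0 expn_gt0.
rewrite /powR gt_eqF ?ltr0n //.
have N0 : (N%:R : R) \is Num.pos by rewrite posrE ltr0n.
rewrite -[X in X <= _](lnK N0) ler_expR.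
(* From a 3^b >= 2^(b+1) and r <= 4 (b + 1). *)
have lnA : ln 2 / 4 * r%:R <= ln (a * 3 ^ b)%:R :> R.
  have h : (2 ^ b.+1 <= a * 3 ^ b)%N.
    by rewrite expnS leq_mul //; case: (b) => // n; rewrite leq_exp2r.
  apply: le_trans (_ : ln (2 ^+ b.+1) <= _).
    rewrite lnXn // -[_ *+ b.+1]mulr_natr -mulrA ler_pM2l // mulrC ler_pdivrMr //.
    by rewrite -natrM ler_nat er /a; have := ltn_pmod (r - 2) (isT : (0 < 3)%N); clear; lia.
  by rewrite ler_ln ?posrE ?exprn_gt0 ?ltr0n // -natrX ler_nat.
have kz : z <= k%:R.
  by apply: le_trans (ltW zu) _; rewrite ler_nat /k addnS ltnS leq_addr.
have eN : ln N%:R = z * (ln 2 / 8 * r%:R) by rewrite /z; field; rewrite !gt_eqF.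
rewrite eN; apply: le_trans (_ : k%:R * (ln 2 / 8 * r%:R) <= _).
  by rewrite ler_wpM2r // mulr_ge0 ?divr_ge0 ?ltW.
have k0 : 0 <= k%:R :> R by [].
move: lnA k0; move: (ln _) (k%:R) (r%:R) => A y w lnA k0.
nra.
Qed.
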